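(* For every integer $n\ge1$, $\mathbb{E}\,2^{C(\sigma)}=n+1$.
   Context: The expectation $\mathbb{E}$ is with respect to a uniformly random permutation $\sigma$ in the symmetric group $\mathcal{S}_n$ on $\{1,\ldots,n\}$, and $C(\sigma)$ is the total number of cycles of $\sigma$ (fixed points count as cycles of length 1). *)

(* Defs.v *)
From mathcomp Require Import all_boot all_order all_algebra all_fingroup.

Set Implicit Arguments.
Unset Strict Implicit.
Unset Printing Implicit Defensive.

Import GRing.Theory Num.Theory.

Local Open Scope ring_scope.

(* Expectation of X(w) for w uniformly distributed on the finite type T
   (meaningful for nonempty T; 'S_n always contains the identity). *)
Definition unif_expectation (R : realFieldType) (T : finType) (X : T -> R) : R :=
  (\sum_(w : T) X w) / #|T|%:R.

(* The cycles of s are its orbits on 'I_n = {0, ..., n-1}; the orbit of a fixed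
   point is a singleton, so fixed points count as cycles of length 1. *)
Definition cycle_count (n : nat) (s : 'S_n) : nat := #|porbits s|.

(* Main.v *)
Require Import Defs.
From mathcomp Require Import all_boot all_order all_algebra all_fingroup.

Import GRing.Theory Num.Theory.
Local Open Scope ring_scope.

(** Expanding [2 ^ C(s)] as a count of sets turns the expectation into a count
    of orbits.  A set is invariant under [s] exactly when it is a union of
    cycles of [s], so [2 ^ C(s)] is the number of subsets of [{1, ..., n}]
    fixed by [s] ([card_fixed_sets]).  By the Cauchy-Frobenius (Burnside)
    lemma, the average over the symmetric group of the number of fixed subsets
    is the number of orbits of that group on subsets.  Two subsets lie in the
    same orbit exactly when they have the same cardinality ([orbit_setP]), and
    the possible cardinalities are [0, ..., n], so there are [n + 1] orbits
    ([card_set_orbits]). *)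

Lemma perm_fixed_porbit (T : finType) (s : {perm T}) (A : {set T}) (x y : T) :
  s @: A = A -> x \in A -> y \in porbit s x -> y \in A.
Proof.
move=> sA Ax /porbitP[i ->]; elim: i => [|i IHi]; first by rewrite perm1.
by rewrite expgSr permM -sA imset_f.
Qed.

(** Choosing a fixed set amounts to choosing which cycles it contains: [cover]
    maps a set of cycles to its union, and [porbit s @: _] recovers the
    cycles from the union because distinct cycles are disjoint and nonempty. *)
Lemma card_fixed_sets (T : finType) (s : {perm T}) :
  #|[set A : {set T} | s @: A == A]| = (2 ^ #|porbits s|)%N.
Proof.
rewrite -card_powerset.
have coverK : {in powerset (porbits s), cancel cover (fun A => porbit s @: A)}.
  move=> C; rewrite powersetE => /subsetP sC; apply/setP=> c.
  have blockE d x : d \in C -> x \in d -> porbit s x = d.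
    by move=> /sC/imsetP[z _ ->] xz; apply/eqP; rewrite eq_porbit_mem.
  apply/imsetP/idP => [[x /bigcupP[d Cd dx] ->]|Cc]; first by rewrite (blockE d).
  have /imsetP[z _ cE] := sC c Cc.
  by exists z => //; apply/bigcupP; exists c => //; rewrite cE porbit_id.
rewrite -(card_in_imset (can_in_inj coverK)); congr #|pred_of_set _|.
apply/setP=> A; rewrite inE; apply/eqP/imsetP => [sA | [C]].
  exists (porbit s @: A); first by rewrite powersetE imsetS //; apply/subsetP.
  rewrite cover_imset; apply/setP=> y; apply/idP/bigcupP => [Ay|[x Ax]].
    by exists y; rewrite // porbit_id.
  exact: perm_fixed_porbit.
rewrite powersetE => /subsetP sC ->.
(* An injective map sending a finite set into itself is onto it. *)
apply/eqP; rewrite eqEcard (card_imset _ perm_inj) leqnn andbT.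
apply/subsetP=> _ /imsetP[x /bigcupP[c Cc cx] ->]; apply/bigcupP; exists c => //.
have /imsetP[z _ cE] := sC c Cc; move: cx; rewrite cE -!eq_porbit_mem.
by have := porbit_perm s 1 x; rewrite expg1 => ->.
Qed.

(** List each set followed by its complement; the permutation that sends the
    i-th element of one list to the i-th element of the other carries the
    first set to the second. *)
Lemma exists_perm_imset (T : finType) (A B : {set T}) :
  #|A| = #|B| -> exists s : {perm T}, s @: A = B.
Proof.
pose l (X : {set T}) := enum X ++ enum (~: X).
have l_uniq X : uniq (l X).
  rewrite cat_uniq !enum_uniq andbT /=.
  by apply/hasPn=> x; rewrite !mem_enum inE.
have l_all X x : x \in l X by rewrite mem_cat !mem_enum inE orbN.
have l_size X : size (l X) = #|T| by rewrite size_cat -!cardE cardsC.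
move=> eqAB; pose f x := nth x (l B) (index x (l A)).
have index_lt x : (index x (l A) < size (l B))%N.
  by rewrite l_size -(l_size A) index_mem l_all.
have f_inj : injective f.
  move=> x y /eqP; rewrite /f (set_nth_default x) // nth_uniq //.
  by move=> /eqP/index_inj-> //; apply: l_all.
exists (perm f_inj); apply/eqP; rewrite eqEcard (card_imset _ perm_inj) eqAB.
rewrite leqnn andbT; apply/subsetP=> _ /imsetP[x Ax ->]; rewrite permE /f.
have xA : x \in enum A by rewrite mem_enum.
have ltxB : (index x (enum A) < size (enum B))%N.
  by rewrite -cardE -eqAB cardE index_mem.
by rewrite index_cat xA nth_cat ltxB -mem_enum mem_nth.
Qed.

Lemma orbit_setP (T : finType) (A : {set T}) :
  orbit ('P^*)%act [set: {perm T}] A = [set B : {set T} | #|B| == #|A|].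
Proof.
apply/setP=> B; rewrite inE; apply/orbitP/eqP => [[s _ <-] | eqBA].
  exact: card_setact.
have [s sAB] := exists_perm_imset T A B (esym eqBA).
by exists s; rewrite ?inE.
Qed.

(** Each cardinality from [0] to [#|T|] is attained, so the orbits are indexed
    without repetition by ['I_#|T|.+1]. *)
Lemma card_set_orbits (T : finType) :
  #|orbit ('P^*)%act [set: {perm T}] @: [set: {set T}]| = #|T|.+1.
Proof.
pose level (k : 'I_#|T|.+1) := [set A : {set T} | #|A| == k].
have level_ex (k : 'I_#|T|.+1) : exists A, A \in level k.
  by apply/set0Pn; rewrite -card_gt0 card_draws bin_gt0 -ltnS.
have level_inj : injective level.
  move=> j k eq_jk; have [A Aj] := level_ex j.
  move: (Aj); rewrite eq_jk; move: Aj; rewrite !inE => /eqP-> /eqP.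
  exact: val_inj.
rewrite -[RHS]card_ord -(card_imset _ level_inj); congr #|pred_of_set _|.
apply/setP=> O; apply/imsetP/imsetP => [[A _ ->] | [k _ ->]].
  exists (Ordinal (max_card (mem A) : #|A| < #|T|.+1)%N) => //.
  exact: orbit_setP.
have [A] := level_ex k; rewrite inE => /eqP Ak.
by exists A; rewrite // orbit_setP Ak.
Qed.

Theorem theorem1p24 (R : realFieldType) (n : nat) (hn : (1 <= n)%N) :
  unif_expectation (fun s : 'S_n => (2%:R : R) ^+ cycle_count s) = n%:R + 1.
Proof.
have burnside : (\sum_(s : 'S_n) 2 ^ #|porbits s| = n.+1 * #|'S_n|)%N.
  have acts_all : [acts [set: 'S_n], on [set: {set 'I_n}] | ('P^*)%act].
    by apply/actsP=> s _ A; rewrite !inE.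
  have := Frobenius_Cauchy acts_all.
  rewrite card_set_orbits card_ord cardsT => <-.
  apply: eq_big => [s | s _]; rewrite ?inE // -card_fixed_sets.
  apply: eq_card => A; rewrite 2!inE in_setT /=.
  exact/eqP/afix1P.
have cardS_neq0 : #|'S_n|%:R != 0 :> R.
  by rewrite pnatr_eq0 -lt0n; apply/card_gt0P; exists 1%g.
rewrite /unif_expectation /cycle_count.
under eq_bigr => s _ do rewrite -natrX.
by rewrite -natr_sum burnside natrM mulfK // -natr1.
Qed.
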